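(* Let $\mathcal{A}$ be a Banach algebra. If $(\mathcal{A}^{**},\square)$ is approximately weakly amenable, then $\mathcal{A}$ is essential.
   Context: For a Banach algebra $\mathcal{A}$, the dual $\mathcal{A}^*$ is a Banach $\mathcal{A}$-bimodule via $\langle a\cdot f,b\rangle=\langle f,ba\rangle$, $\langle f\cdot a,b\rangle=\langle f,ab\rangle$. $\square$ denotes the first Arens product on $\mathcal{A}^{**}$: if $(a_\alpha),(b_\beta)$ are nets in $\mathcal{A}$ converging weak-* to $a^{**},b^{**}$ in $\mathcal{A}^{**}$, then $a^{**}\square b^{**}=\omega^*\text{-}\lim_\alpha\lim_\beta a_\alpha b_\beta$; with it $\mathcal{A}^{**}$ is a Banach algebra. A derivation from a Banach algebra $\mathcal{C}$ into a Banach $\mathcal{C}$-bimodule $X$ is a bounded linear map $D$ with $D(ab)=D(a)\cdot b+a\cdot D(b)$. It is approximately inner if there is a net $(x_i)$ in $X$ with $D(a)=\lim_i(a\cdot x_i-x_i\cdot a)$ in norm for every $a\in\mathcal{C}$. A Banach algebra $\mathcal{C}$ is approximately weakly amenable if every derivation $D:\mathcal{C}\to\mathcal{C}^*$ is approximately inner. A Banach algebra $\mathcal{A}$ is essential if $\mathcal{A}^2$ (the linear span of the products $ab$, $a,b\in\mathcal{A}$) is dense in $\mathcal{A}$. *)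

(* Defs.v *)
From HB Require Import structures.
From mathcomp Require Import all_boot all_order all_algebra.
From mathcomp Require Import all_classical reals topology normedtype.
From mathcomp Require Import complex.

Set Implicit Arguments.
Unset Strict Implicit.
Unset Printing Implicit Defensive.
Import Order.TTheory GRing.Theory Num.Theory.
Import numFieldNormedType.Exports.

Local Open Scope classical_set_scope.
Local Open Scope ring_scope.

(* The scalars of a Banach space, with instances R : realType and R[i]: the two
   axioms are what makes the dual of a normed space a Banach space. The order
   of a numFieldType is partial, so suprema only concern sets of real scalars. *)
HB.mixin Record isScalarField K & Num.NumField K := {
  real_supremums : forall S : set K, S `<=` [set x | x \is Num.real] ->
    S !=set0 -> ubound S !=set0 -> supremums S !=set0 ;
  scalar_complete : forall F : set_system K^o,
    ProperFilter F -> cauchy F -> cvg F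
}.

#[short(type="scalarFieldType")]
HB.structure Definition ScalarField := {K of Num.NumField K & isScalarField K}.

Section real_scalars.
Variable R : realType.

Lemma realType_supremums (S : set R) : S `<=` [set x | x \is Num.real] ->
  S !=set0 -> ubound S !=set0 -> supremums S !=set0.
Proof.
move=> _ S0 ubS; exists (sup S); split.
  by apply/ubP => x Sx; apply: ub_le_sup.
by apply/lbP => y yS; apply: ge_sup.
Qed.

HB.instance Definition _ :=
  isScalarField.Build R realType_supremums (@R_complete R).
End real_scalars.

Section complex_scalars.
Variable R : realType.
Local Notation C := (R[i]%C).

Lemma complex_supremums (S : set C) : S `<=` [set x | x \is Num.real] ->
  S !=set0 -> ubound S !=set0 -> supremums S !=set0.
Proof.
move=> Sreal [x0 Sx0] [b bS].
have realE (x : C) : x \is Num.real -> x = (complex.Re x)%:C%C.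
  by move=> xr; rewrite RRe_real.
have ubR (y : C) : ubound S y -> y \is Num.real.
  move=> yS; have := yS _ Sx0 => x0y.
  by rewrite -(ler_real x0y); exact: Sreal.
have br := ubR _ bS.
exists (sup (@complex.Re R @` S))%:C%C; split.
  move=> x Sx; rewrite (realE _ (Sreal _ Sx)) lecR.
  apply: ub_le_sup; last by exists x.
  exists (complex.Re b) => _ [y Sy <-]; rewrite -lecR.
  by rewrite -(realE _ (Sreal _ Sy)) -(realE _ br); exact: bS.
move=> y yS; rewrite (realE _ (ubR _ yS)) lecR; apply: ge_sup.
  by exists (complex.Re x0), x0.
move=> _ [z Sz <-]; rewrite -lecR -(realE _ (Sreal _ Sz)).
by rewrite -(realE _ (ubR _ yS)); exact: yS.
Qed.

Lemma complex_complete (F : set_system C^o) :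
  ProperFilter F -> cauchy F -> cvg F.
Proof.
move=> FF /cauchyP Fc.
have part (p : C -> R) : (forall x y, p (x - y) = p x - p y) ->
    (forall x, `|p x|%:C%C <= `|x|) -> cvg (p @ F).
  move=> pB pn; apply: R_complete; apply: cauchy_exP => e e0.
  have e0' : 0 < e%:C%C by rewrite ltcR.
  have [x Fx] := Fc _ e0'; exists (p x).
  suff : F [set y : C | `|p x - p y| < e] by [].
  apply: (filterS _ Fx) => y xy /=; rewrite -ltcR.
  by have := pn ((x : C) - y); rewrite pB => /le_lt_trans; apply; exact: xy.
have /cvg_ex[/= a Fa] : cvg (@complex.Re R @ F).
  by apply: part => [[? ?] [? ?]//|]; exact: normc_ge_Re.
have ImD (x y : C) : complex.Im (x - y) = complex.Im x - complex.Im y.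
  by case: x y => [? ?] [? ?].
have /cvg_ex[/= b Fb] : cvg (@complex.Im R @ F).
  apply: part => [//|[x y]]; rewrite normc_def lecR /=.
  by rewrite -sqrtr_sqr ler_wsqrtr// lerDr sqr_ge0.
apply/cvg_ex; exists (a +i* b)%C; apply/cvgrPdist_lt => e e0.
have er : e = (complex.Re e)%:C%C by rewrite RRe_real// gtr0_real.
have d0 : 0 < complex.Re e / 2 by rewrite divr_gt0// -ltcR -er.
near=> z.
have az : `|a - complex.Re z| < complex.Re e / 2.
  by near: z; move/cvgrPdist_lt: Fa; exact.
have bz : `|b - complex.Im z| < complex.Re e / 2.
  by near: z; move/cvgrPdist_lt: Fb; exact.
have -> : (a +i* b)%C - z = (a - complex.Re z)%:C%C +
    'i%C * (b - complex.Im z)%:C%C.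
  by case: (z) => x y; simpc.
have -> : e = (complex.Re e / 2)%:C%C + (complex.Re e / 2)%:C%C.
  by rewrite -rmorphD/= -splitr.
apply: le_lt_trans (ler_normD _ _) _; apply: ltrD.
  by rewrite normc_def/= expr0n addr0 sqrtr_sqr ltcR.
by rewrite normrM !normc_def/= !expr0n expr1n add0r addr0 sqrtr1 mul1r sqrtr_sqr ltcR.
Unshelve. all: by end_near. Qed.

HB.instance Definition _ :=
  isScalarField.Build C complex_supremums complex_complete.
End complex_scalars.
(* The space of bounded linear functionals on V. *)
Record dual (K : scalarFieldType) (V : normedModType K) := Dual {
  dual_fun :> V -> K^o ;
  dual_linear : linear dual_fun ;
  dual_bounded : exists M : K, forall x, `|dual_fun x| <= M * `|x|
}.

Section dual_space.
Variables (K : scalarFieldType) (V : normedModType K).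
Implicit Types f g : dual V.

HB.instance Definition _ f :=
  GRing.isLinear.Build K V K^o _ (dual_fun f) (dual_linear f).

Lemma dualP f g : (forall x, f x = g x) -> f = g.
Proof.
case: f g => [f lf bf] [g lg bg] /= /funext fg; subst g.
by congr Dual; exact: Prop_irrelevance.
Qed.

HB.instance Definition _ := gen_eqMixin (dual V).
HB.instance Definition _ := gen_choiceMixin (dual V).

Lemma dual_boundP f :
  exists2 M : K, 0 <= M & forall x, `|f x| <= M * `|x|.
Proof.
have [M fM] := dual_bounded f; exists `|M| => // x.
apply: le_trans (fM x) _; have /ger0_norm <- := le_trans (normr_ge0 _) (fM x).
by rewrite normrM normr_id.
Qed.

Lemma zero_subproof1 : linear (fun _ : V => 0 : K^o).
Proof. by move=> k x y; rewrite scaler0 addr0. Qed.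
Lemma zero_subproof2 : exists M : K, forall x : V, `|0 : K^o| <= M * `|x|.
Proof. by exists 0 => x; rewrite normr0 mul0r. Qed.
Definition dual_zero := Dual zero_subproof1 zero_subproof2.

Lemma opp_subproof1 f : linear (fun x => - f x).
Proof. by move=> k x y; rewrite linearP opprD scalerN. Qed.
Lemma opp_subproof2 f : exists M : K, forall x, `|- f x| <= M * `|x|.
Proof. by have [M fM] := dual_bounded f; exists M => x; rewrite normrN. Qed.
Definition dual_opp f := Dual (opp_subproof1 f) (opp_subproof2 f).

Lemma add_subproof1 f g : linear (fun x => f x + g x).
Proof. by move=> k x y; rewrite !linearP scalerDr addrACA. Qed.
Lemma add_subproof2 f g : exists M : K, forall x, `|f x + g x| <= M * `|x|.
Proof.
have [M fM] := dual_bounded f; have [N gN] := dual_bounded g.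
exists (M + N) => x; rewrite mulrDl.
by apply: le_trans (ler_normD _ _) _; apply: lerD.
Qed.
Definition dual_add f g := Dual (add_subproof1 f g) (add_subproof2 f g).

Lemma scale_subproof1 (k : K) f : linear (fun x => k *: f x).
Proof. by move=> l x y; rewrite linearP scalerDr !scalerA mulrC. Qed.
Lemma scale_subproof2 (k : K) f : exists M : K, forall x, `|k *: f x| <= M * `|x|.
Proof.
have [M fM] := dual_bounded f; exists (`|k| * M) => x.
by rewrite normrZ -mulrA ler_wpM2l.
Qed.
Definition dual_scale (k : K) f :=
  Dual (scale_subproof1 k f) (scale_subproof2 k f).

Lemma dual_addA : associative dual_add.
Proof. by move=> f g h; apply: dualP => x /=; rewrite addrA. Qed.
Lemma dual_addC : commutative dual_add.
Proof. by move=> f g; apply: dualP => x /=; rewrite addrC. Qed.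
Lemma dual_add0 : left_id dual_zero dual_add.
Proof. by move=> f; apply: dualP => x /=; rewrite add0r. Qed.
Lemma dual_addN : left_inverse dual_zero dual_opp dual_add.
Proof. by move=> f; apply: dualP => x /=; rewrite addNr. Qed.

HB.instance Definition _ :=
  GRing.isZmodule.Build (dual V) dual_addA dual_addC dual_add0 dual_addN.

Lemma dual_scaleA k l f : dual_scale k (dual_scale l f) = dual_scale (k * l) f.
Proof. by apply: dualP => x /=; rewrite scalerA. Qed.
Lemma dual_scale1 : left_id 1 dual_scale.
Proof. by move=> f; apply: dualP => x /=; rewrite scale1r. Qed.
Lemma dual_scaleDr : right_distributive dual_scale +%R.
Proof. by move=> k f g; apply: dualP => x /=; rewrite scalerDr. Qed.
Lemma dual_scaleDl f : {morph dual_scale^~ f : k l / k + l}.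
Proof. by move=> k l; apply: dualP => x /=; rewrite scalerDl. Qed.

HB.instance Definition _ := GRing.Zmodule_isLmodule.Build K (dual V)
  dual_scaleA dual_scale1 dual_scaleDr dual_scaleDl.

Lemma dualD f g x : (f + g) x = f x + g x. Proof. by []. Qed.
Lemma dualN f x : (- f) x = - f x. Proof. by []. Qed.
Lemma dualB f g x : (f - g) x = f x - g x. Proof. by []. Qed.
Lemma dualZ (k : K) f x : (k *: f) x = k *: f x. Proof. by []. Qed.
Lemma dual0 x : (0 : dual V) x = 0. Proof. by []. Qed.

(* The set is nonempty and bounded (dual_norm_isLub), so this is its least
   upper bound and the default value 0 plays no role. *)
Definition dual_norm f : K :=
  supremum 0 [set `|f x| | x in [set x : V | `|x| <= 1]].

Let unit_image f := [set `|f x| | x in [set x : V | `|x| <= 1]].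

Lemma dual_norm_isLub f : supremums (unit_image f) (dual_norm f).
Proof.
have ne : unit_image f !=set0.
  by exists `|f 0|, 0 => //=; rewrite normr0 ler01.
have [s hs] : supremums (unit_image f) !=set0.
  apply: real_supremums => //; first by move=> _ [x _ <-] /=; exact: normr_real.
  have [M M0 fM] := dual_boundP f; exists M => _ [x /= x1 <-].
  by apply: le_trans (fM x) _; rewrite -[leRHS]mulr1 ler_wpM2l.
rewrite /dual_norm /supremum; case: ifPn => [/eqP E|_].
  by move: ne; rewrite /unit_image E => -[].
by case: xgetP => [y _ //|/(_ s)]; case.
Qed.

Lemma dual_norm_ge0 f : 0 <= dual_norm f.
Proof.
have [h _] := dual_norm_isLub f.
apply: (@le_trans _ _ `|f 0|) => //.
by apply: h; exists 0 => //=; rewrite normr0 ler01.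
Qed.

Lemma dual_norm_ler f x : `|f x| <= dual_norm f * `|x|.
Proof.
have [->|x0] := eqVneq x 0; first by rewrite linear0 !normr0 mulr0.
have nx0 : 0 < `|x| by rewrite normr_gt0.
have [h _] := dual_norm_isLub f.
rewrite -ler_pdivrMr // mulrC -[X in X * _]ger0_norm ?invr_ge0// -normrZ -linearZ.
apply: h; exists (`|x|^-1 *: x) => //=.
by rewrite normrZ normfV normr_id mulVf ?gt_eqF.
Qed.

Lemma ler_dual_norm f (M : K) :
  0 <= M -> (forall x, `|f x| <= M * `|x|) -> dual_norm f <= M.
Proof.
move=> M0 fM; have [_ h] := dual_norm_isLub f; apply: h => _ [x /= x1 <-].
by apply: le_trans (fM x) _; rewrite -[leRHS]mulr1 ler_wpM2l.
Qed.

Lemma dual_norm_triangle f g : dual_norm (f + g) <= dual_norm f + dual_norm g.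
Proof.
apply: ler_dual_norm => [|x]; first by rewrite addr_ge0 ?dual_norm_ge0.
rewrite dualD mulrDl; apply: le_trans (ler_normD _ _) _.
by apply: lerD; exact: dual_norm_ler.
Qed.

Lemma dual_normZ (k : K) f : dual_norm (k *: f) = `|k| * dual_norm f.
Proof.
apply/eqP; rewrite eq_le; apply/andP; split.
  apply: ler_dual_norm => [|x]; first by rewrite mulr_ge0 ?dual_norm_ge0.
  by rewrite dualZ normrZ -mulrA ler_wpM2l ?dual_norm_ler.
have [->|k0] := eqVneq k 0; first by rewrite normr0 mul0r dual_norm_ge0.
rewrite -ler_pdivlMl ?normr_gt0//; apply: ler_dual_norm => [|x].
  by rewrite mulr_ge0 ?invr_ge0 ?dual_norm_ge0.
rewrite -mulrA ler_pdivlMl ?normr_gt0// -normrZ -dualZ.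
exact: dual_norm_ler.
Qed.

Lemma dual_norm0_eq0 f : dual_norm f = 0 -> f = 0.
Proof.
move=> f0; apply: dualP => x; apply/eqP; rewrite -normr_le0.
by have := dual_norm_ler f x; rewrite f0 mul0r.
Qed.

HB.instance Definition _ := Lmodule_isNormed.Build K (dual V)
  dual_norm_triangle dual_normZ dual_norm0_eq0.

Lemma dual_normE f :
  `|f| = supremum 0 [set `|f x| | x in [set x : V | `|x| <= 1]].
Proof. by []. Qed.

Lemma ler_dual f x : `|f x| <= `|f| * `|x|.
Proof. exact: dual_norm_ler. Qed.

Lemma dual_complete (F : set_system (dual V)) :
  ProperFilter F -> cauchy F -> cvg F.
Proof.
move=> FF /cauchyP Fc.
have Fc' (e : K) : 0 < e -> exists f0, F [set f | `|f0 - f| < e].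
  by move=> /Fc[f0 Ff0]; exists f0; move: Ff0; rewrite -ball_normE.
have Fx (x : V) : cvg ((fun f : dual V => f x) @ F).
  apply: scalar_complete; apply: cauchy_exP => e e0.
  have x1 : 0 < `|x| + 1 by rewrite ltr_wpDl.
  have [f0 Ff0] := Fc' (e / (`|x| + 1)) (divr_gt0 e0 x1); exists (f0 x).
  suff : F [set f : dual V | `|f0 x - f x| < e] by [].
  apply: (filterS _ Ff0) => f /= ff0; rewrite -dualB.
  apply: le_lt_trans (ler_dual _ _) _.
  apply: (@le_lt_trans _ _ (`|f0 - f| * (`|x| + 1))).
    by rewrite ler_wpM2l// lerDl.
  by rewrite -ltr_pdivlMr.
pose g x : K^o := lim ((fun f : dual V => f x) @ F).
have gP x : (fun f : dual V => f x) @ F --> g x by exact: Fx.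
have glin : linear g.
  move=> k x y; apply: (cvg_unique (@norm_hausdorff _ K^o) (gP _)).
  have -> : (fun f : dual V => f (k *: x + y)) =
            (fun f : dual V => k *: f x + f y).
    by apply/funext => f; rewrite linearP.
  apply: cvgD; last exact: gP.
  by apply: cvgZl_tmp; exact: gP.
have gdist (f0 : dual V) (e : K) : F [set f | `|f0 - f| < e] ->
    forall x, `|f0 x - g x| <= e * `|x|.
  move=> Ff0 x; apply/ler_addgt0Pr => d d0.
  have /cvgrPdist_lt /(_ _ d0) gd := gP x.
  near F => f.
  have fd : `|g x - f x| < d by near: f.
  have f0f : `|f0 - f| < e by near: f.
  rewrite -(subrKA (f x)); apply: le_trans (ler_normD _ _) _.
  apply: lerD; last by rewrite distrC ltW.
  by rewrite -dualB; apply: le_trans (ler_dual _ _) _; rewrite ler_wpM2r// ltW.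
have gbnd : exists M : K, forall x, `|g x| <= M * `|x|.
  have [f0 Ff0] := Fc' 1 ltr01; exists (`|f0| + 1) => x.
  rewrite -[X in `|X|](subKr (f0 x)); apply: le_trans (ler_normB _ _) _.
  by rewrite mulrDl lerD ?ler_dual ?gdist.
apply/cvg_ex; exists (Dual glin gbnd); apply/cvgrPdist_le => e e0.
have e20 : 0 < e / 2 by rewrite divr_gt0.
have [f0 Ff0] := Fc' _ e20; near=> f.
have ff0 : `|f0 - f| < e / 2 by near: f.
rewrite -(subrKA f0) [e]splitr; apply: le_trans (ler_normD _ _) _.
apply: lerD; last exact: ltW.
apply: ler_dual_norm => [|x]; first exact: ltW.
by rewrite dualB distrC; exact: gdist.
Unshelve. all: by end_near. Qed.

HB.instance Definition _ := Uniform_isComplete.Build (dual V) dual_complete.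
End dual_space.

(* Banach algebras are not assumed to be unital. *)
HB.mixin Record isBanachAlgebra (K : numFieldType) A & CompleteNormedModule K A := {
  bmul : A -> A -> A ;
  bmulA : associative bmul ;
  bmulDl : left_distributive bmul +%R ;
  bmulDr : right_distributive bmul +%R ;
  bmulZl : forall (k : K) (a b : A), bmul (k *: a) b = k *: bmul a b ;
  bmulZr : forall (k : K) (a b : A), bmul a (k *: b) = k *: bmul a b ;
  bmul_normM : forall a b : A, `|bmul a b| <= `|a| * `|b|
}.

#[short(type="banachAlgType")]
HB.structure Definition BanachAlgebra (K : numFieldType) :=
  {A of CompleteNormedModule K A & isBanachAlgebra K A}.

HB.mixin Record isBanachBimodule (K : numFieldType) (A : banachAlgType K) X
    & CompleteNormedModule K X := {
  lact : A -> X -> X ;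
  ract : X -> A -> X ;
  lactDl : forall (a b : A) (x : X), lact (a + b) x = lact a x + lact b x ;
  lactDr : forall (a : A) (x y : X), lact a (x + y) = lact a x + lact a y ;
  lactZl : forall (k : K) (a : A) (x : X), lact (k *: a) x = k *: lact a x ;
  lactZr : forall (k : K) (a : A) (x : X), lact a (k *: x) = k *: lact a x ;
  ractDl : forall (x y : X) (a : A), ract (x + y) a = ract x a + ract y a ;
  ractDr : forall (x : X) (a b : A), ract x (a + b) = ract x a + ract x b ;
  ractZl : forall (k : K) (x : X) (a : A), ract (k *: x) a = k *: ract x a ;
  ractZr : forall (k : K) (x : X) (a : A), ract x (k *: a) = k *: ract x a ;
  lactA : forall (a b : A) (x : X), lact (bmul a b) x = lact a (lact b x) ;
  ractA : forall (x : X) (a b : A), ract x (bmul a b) = ract (ract x a) b ;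
  lractA : forall (a : A) (x : X) (b : A), ract (lact a x) b = lact a (ract x b) ;
  act_bounded : exists M : K, forall (a : A) (x : X),
    `|lact a x| <= M * (`|a| * `|x|) /\ `|ract x a| <= M * (`|x| * `|a|)
}.

#[short(type="banachBimodType")]
HB.structure Definition BanachBimodule (K : numFieldType) (A : banachAlgType K) :=
  {X of CompleteNormedModule K X & isBanachBimodule K A X}.

Section dual_bimodule.
Variables (K : scalarFieldType) (A : banachAlgType K).
Implicit Types (a b : A) (f : dual A).

Lemma dual_lact_linear a f : linear (fun b => f (bmul b a)).
Proof. by move=> k x y; rewrite bmulDl bmulZl linearP. Qed.
Lemma dual_lact_le a f b : `|f (bmul b a)| <= (`|a| * `|f|) * `|b|.
Proof.
apply: le_trans (ler_dual _ _) _; rewrite (mulrC `|a|) -mulrA ler_wpM2l// mulrC.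
exact: bmul_normM.
Qed.
Lemma dual_lact_bounded a f :
  exists M : K, forall b, `|f (bmul b a)| <= M * `|b|.
Proof. by exists (`|a| * `|f|) => b; exact: dual_lact_le. Qed.
Definition dual_lact a f : dual A :=
  Dual (dual_lact_linear a f) (dual_lact_bounded a f).

Lemma dual_ract_linear f a : linear (fun b => f (bmul a b)).
Proof. by move=> k x y; rewrite bmulDr bmulZr linearP. Qed.
Lemma dual_ract_le f a b : `|f (bmul a b)| <= (`|f| * `|a|) * `|b|.
Proof.
apply: le_trans (ler_dual _ _) _; rewrite -mulrA ler_wpM2l//.
exact: bmul_normM.
Qed.
Lemma dual_ract_bounded f a :
  exists M : K, forall b, `|f (bmul a b)| <= M * `|b|.
Proof. by exists (`|f| * `|a|) => b; exact: dual_ract_le. Qed.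
Definition dual_ract f a : dual A :=
  Dual (dual_ract_linear f a) (dual_ract_bounded f a).

Lemma dual_lactDl a b f : dual_lact (a + b) f = dual_lact a f + dual_lact b f.
Proof. by apply: dualP => c /=; rewrite bmulDr linearD. Qed.
Lemma dual_lactDr a f g : dual_lact a (f + g) = dual_lact a f + dual_lact a g.
Proof. by apply: dualP. Qed.
Lemma dual_lactZl (k : K) a f : dual_lact (k *: a) f = k *: dual_lact a f.
Proof. by apply: dualP => c /=; rewrite bmulZr linearZ. Qed.
Lemma dual_lactZr (k : K) a f : dual_lact a (k *: f) = k *: dual_lact a f.
Proof. by apply: dualP. Qed.
Lemma dual_ractDl f g a : dual_ract (f + g) a = dual_ract f a + dual_ract g a.
Proof. by apply: dualP. Qed.
Lemma dual_ractDr f a b : dual_ract f (a + b) = dual_ract f a + dual_ract f b.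
Proof. by apply: dualP => c /=; rewrite bmulDl linearD. Qed.
Lemma dual_ractZl (k : K) f a : dual_ract (k *: f) a = k *: dual_ract f a.
Proof. by apply: dualP. Qed.
Lemma dual_ractZr (k : K) f a : dual_ract f (k *: a) = k *: dual_ract f a.
Proof. by apply: dualP => c /=; rewrite bmulZl linearZ. Qed.
Lemma dual_lactA a b f : dual_lact (bmul a b) f = dual_lact a (dual_lact b f).
Proof. by apply: dualP => c /=; rewrite bmulA. Qed.
Lemma dual_ractA f a b : dual_ract f (bmul a b) = dual_ract (dual_ract f a) b.
Proof. by apply: dualP => c /=; rewrite bmulA. Qed.
Lemma dual_lractA a f b :
  dual_ract (dual_lact a f) b = dual_lact a (dual_ract f b).
Proof. by apply: dualP => c /=; rewrite bmulA. Qed.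
Lemma dual_lact_norm a f : `|dual_lact a f| <= `|a| * `|f|.
Proof. by apply: ler_dual_norm => [|b]; rewrite ?mulr_ge0//; exact: dual_lact_le. Qed.
Lemma dual_ract_norm f a : `|dual_ract f a| <= `|f| * `|a|.
Proof. by apply: ler_dual_norm => [|b]; rewrite ?mulr_ge0//; exact: dual_ract_le. Qed.
Lemma dual_act_bounded : exists M : K, forall a f,
  `|dual_lact a f| <= M * (`|a| * `|f|) /\ `|dual_ract f a| <= M * (`|f| * `|a|).
Proof.
by exists 1 => a f; rewrite !mul1r; split; [exact: dual_lact_norm|exact: dual_ract_norm].
Qed.

HB.instance Definition _ := isBanachBimodule.Build K A (dual A)
  dual_lactDl dual_lactDr dual_lactZl dual_lactZr
  dual_ractDl dual_ractDr dual_ractZl dual_ractZr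
  dual_lactA dual_ractA dual_lractA dual_act_bounded.

Lemma dual_lactE a f b : (lact a f : dual A) b = f (bmul b a).
Proof. by []. Qed.
Lemma dual_ractE f a b : (ract f a : dual A) b = f (bmul a b).
Proof. by []. Qed.
End dual_bimodule.

Definition bidual (K : scalarFieldType) (A : normedModType K) : Type :=
  dual (dual A).

HB.instance Definition _ (K : scalarFieldType) (A : normedModType K) :=
  CompleteNormedModule.on (bidual A).

Section arens.
Variables (K : scalarFieldType) (A : banachAlgType K).
Implicit Types (a b : A) (f : dual A) (m n p : bidual A).

(* The functional n . f in A^*, <n . f, a> = <n, f . a>. *)
Lemma arens_lact_linear n f : linear (fun a => dual_fun n (ract f a)).
Proof. by move=> k x y; rewrite ractDr ractZr linearP. Qed.
Lemma arens_lact_le n f a : `|dual_fun n (ract f a)| <= (`|n| * `|f|) * `|a|.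
Proof.
apply: le_trans (ler_dual _ _) _; rewrite -mulrA ler_wpM2l//.
exact: dual_ract_norm.
Qed.
Lemma arens_lact_bounded n f :
  exists M : K, forall a, `|dual_fun n (ract f a)| <= M * `|a|.
Proof. by exists (`|n| * `|f|) => a; exact: arens_lact_le. Qed.
Definition arens_lact n f : dual A :=
  Dual (arens_lact_linear n f) (arens_lact_bounded n f).

Lemma arens_lact_norm n f : `|arens_lact n f| <= `|n| * `|f|.
Proof. by apply: ler_dual_norm => [|b]; rewrite ?mulr_ge0//; exact: arens_lact_le. Qed.

(* First Arens product: <m [] n, f> = <m, n . f>. Lemma arens_iterated_limit
   below identifies it with the iterated weak-* limit along arbitrary nets of A
   converging to m and n, which exist by canon_weak_star_dense. *)
Lemma arens_linear m n : linear (fun f => dual_fun m (arens_lact n f)).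
Proof.
move=> k f g; rewrite -linearP; congr (dual_fun m _).
by apply: dualP => a /=; rewrite ractDl ractZl linearP.
Qed.
Lemma arens_le m n f : `|dual_fun m (arens_lact n f)| <= (`|m| * `|n|) * `|f|.
Proof.
apply: le_trans (ler_dual _ _) _; rewrite -mulrA ler_wpM2l//.
exact: arens_lact_norm.
Qed.
Lemma arens_bounded m n :
  exists M : K, forall f, `|dual_fun m (arens_lact n f)| <= M * `|f|.
Proof. by exists (`|m| * `|n|) => f; exact: arens_le. Qed.
Definition arens m n : bidual A := Dual (arens_linear m n) (arens_bounded m n).

Lemma arensA : associative arens.
Proof.
move=> m n p; apply: dualP => f /=; congr (dual_fun m _).
apply: dualP => a /=; congr (dual_fun n _).
by apply: dualP => b /=; rewrite ractA.
Qed.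
Lemma arensDl : left_distributive arens +%R.
Proof. by move=> m n p; apply: dualP. Qed.
Lemma arensDr : right_distributive arens +%R.
Proof.
move=> m n p; apply: dualP => f; rewrite dualD /= -linearD.
by congr (dual_fun m _); apply: dualP.
Qed.
Lemma arensZl (k : K) m n : arens (k *: m) n = k *: arens m n.
Proof. by apply: dualP. Qed.
Lemma arensZr (k : K) m n : arens m (k *: n) = k *: arens m n.
Proof.
apply: dualP => f; rewrite dualZ /= -linearZ.
by congr (dual_fun m _); apply: dualP.
Qed.
Lemma arens_norm m n : `|arens m n| <= `|m| * `|n|.
Proof. by apply: ler_dual_norm => [|f]; rewrite ?mulr_ge0//; exact: arens_le. Qed.

HB.instance Definition _ := isBanachAlgebra.Build K (bidual A)
  arensA arensDl arensDr arensZl arensZr arens_norm.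

Lemma bmul_bidualE m n : bmul m n = arens m n.
Proof. by []. Qed.
End arens.

Definition directed (I : Type) (le : I -> I -> Prop) :=
  [/\ exists i : I, True, forall i, le i i,
      forall i j k, le i j -> le j k -> le i k &
      forall i j, exists k, le i k /\ le j k].

(* A net x indexed by the directed set (I, le) converges to l when
   x @ tails le --> l. *)
Definition tails (I : Type) (le : I -> I -> Prop) : set_system I :=
  filter_from setT (fun i => [set j | le i j]).

Lemma tails_proper (I : Type) (le : I -> I -> Prop) :
  directed le -> ProperFilter (tails le).
Proof.
move=> [[i0 _] lexx letr ledir]; apply: filter_from_proper.
  apply: filter_from_filter => [|i j _ _]; first by exists i0.
  have [k [ik jk]] := ledir i j; exists k => // l /= kl.
  by split; apply: letr kl.
by move=> i _; exists i; exact: lexx.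
Qed.

Section weak_star.
Variables (K : scalarFieldType) (A : normedModType K).
Implicit Types (a : A) (f : dual A) (m : bidual A).

Definition weak_star_cvg (I : Type) (le : I -> I -> Prop) (x : I -> bidual A) m :=
  forall f, (dual_fun (x i) f) @[i --> tails le] --> dual_fun m f.

Lemma canon_linear a : linear (fun f : dual A => f a).
Proof. by []. Qed.
Lemma canon_bounded a : exists M : K, forall f, `|f a| <= M * `|f|.
Proof. by exists `|a| => f; rewrite mulrC; exact: ler_dual. Qed.
Definition canon a : bidual A := Dual (canon_linear a) (canon_bounded a).

(* Exact finite interpolation: on finitely many functionals, m agrees with the
   evaluation at some point of A. *)
Lemma interp_ker (s : seq (dual A)) f m a :
  (forall x, (forall g, g \in s -> g x = 0) -> f x = 0) ->
  (forall g, g \in s -> g a = dual_fun m g) -> f a = dual_fun m f.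
Proof.
elim: s f => [|g s IH] f fs sa.
  have -> : f = 0 by apply: dualP => x; apply: fs.
  by rewrite linear0.
have sa' h : h \in s -> h a = dual_fun m h.
  by move=> hs; apply: sa; rewrite inE hs orbT.
have [gs|/existsNP[z /not_implyP[zs /eqP gz]]] :=
    pselect (forall x, (forall h, h \in s -> h x = 0) -> g x = 0).
  apply: IH => // x xs; apply: fs => h; rewrite inE => /orP[/eqP->|]; last exact: xs.
  exact: gs.
suff fgs x : (forall h, h \in s -> h x = 0) -> (f - (f z / g z) *: g) x = 0.
  have := IH (f - (f z / g z) *: g) fgs sa'.
  have -> : dual_fun m (f - (f z / g z) *: g) =
            dual_fun m f - (f z / g z) *: dual_fun m g.
    by rewrite linearB linearZ.
  by rewrite dualB dualZ (sa g (mem_head _ _)); exact: addIr.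
move=> xs; rewrite dualB dualZ.
have lin (h : dual A) :
    h (x - (g x / g z) *: z) = h x - (g x / g z) *: h z.
  by rewrite linearB linearZ.
have : f (x - (g x / g z) *: z) = 0.
  apply: fs => h; rewrite inE lin => /orP[/eqP->|hs].
    by rewrite -[_ *: g z]/(_ * _) divfK// subrr.
  by rewrite (xs _ hs) (zs _ hs) scaler0 subrr.
rewrite lin => /subr0_eq ->.
rewrite -[_ *: f z]/(_ * _) -[_ *: g x]/(_ * _).
by rewrite mulrAC [X in _ - X]mulrAC (mulrC (f z)) subrr.
Qed.

Lemma interp (s : seq (dual A)) m :
  exists a, forall f, f \in s -> f a = dual_fun m f.
Proof.
elim: s => [|f s [a sa]]; first by exists 0.
have [fs|/existsNP[z /not_implyP[zs /eqP fz]]] :=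
    pselect (forall x, (forall g, g \in s -> g x = 0) -> f x = 0).
  exists a => g; rewrite inE => /orP[/eqP->|]; last exact: sa.
  exact: (interp_ker fs).
exists (a + ((dual_fun m f - f a) / f z) *: z) => g.
rewrite inE linearD linearZ /= => /orP[/eqP->|gs].
  by rewrite -[_ *: f z]/(_ * _) divfK// addrC subrK.
by rewrite (zs _ gs) scaler0 addr0 sa.
Qed.

Lemma canon_weak_star_dense m :
  exists (I : Type) (le : I -> I -> Prop) (x : I -> A),
    directed le /\ weak_star_cvg le (fun i => canon (x i)) m.
Proof.
have [x xP] := choice (fun s => interp s m).
pose le (s t : seq (dual A)) := {subset s <= t}.
have dle : directed le.
  split => [|s|s t u st tu|s t]; first by exists [::].
  - by [].
  - by move=> f /st /tu.
  - by exists (s ++ t); split => f fs; rewrite mem_cat fs ?orbT.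
have FF := tails_proper dle.
exists (seq (dual A)), le, x; split => //.
move=> f; apply/cvgrPdist_lt => e e0; exists [:: f] => // s /= fs.
by rewrite xP ?subrr ?normr0//; apply: fs; rewrite mem_head.
Qed.

End weak_star.

Lemma arens_iterated_limit (K : scalarFieldType) (A : banachAlgType K)
    (I J : Type) (leI : I -> I -> Prop) (leJ : J -> J -> Prop)
    (x : I -> A) (y : J -> A) (m n : bidual A) :
  weak_star_cvg leI (fun i => canon (x i)) m -> weak_star_cvg leJ (fun j => canon (y j)) n ->
  exists p : I -> bidual A,
    (forall i, weak_star_cvg leJ (fun j => canon (bmul (x i) (y j))) (p i)) /\
    weak_star_cvg leI p (bmul m n).
Proof.
move=> xm yn; exists (fun i => arens (canon (x i)) n); split => [i f|f].
  exact: (yn (ract f (x i))).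
exact: (xm (arens_lact n f)).
Qed.

Definition derivation (K : numFieldType) (C : banachAlgType K)
    (X : banachBimodType C) (D : C -> X) :=
  [/\ linear D, exists M : K, forall a, `|D a| <= M * `|a| &
      forall a b, D (bmul a b) = ract (D a) b + lact a (D b)].

Definition approximately_inner (K : numFieldType) (C : banachAlgType K)
    (X : banachBimodType C) (D : C -> X) :=
  exists (I : Type) (le : I -> I -> Prop) (x : I -> X),
    directed le /\
    forall a, (lact a (x i) - ract (x i) a) @[i --> tails le] --> D a.

Definition approximately_weakly_amenable (K : scalarFieldType)
    (C : banachAlgType K) :=
  forall D : C -> dual C, derivation D -> approximately_inner D.

Definition linear_span (K : numFieldType) (V : lmodType K) (S : set V) : set V :=
  [set x | exists (n : nat) (c : 'I_n -> K) (v : 'I_n -> V),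
     (forall i, S (v i)) /\ x = \sum_(i < n) c i *: v i].

Definition essential (K : numFieldType) (A : banachAlgType K) :=
  dense (linear_span [set bmul a b | a in [set: A] & b in [set: A]]).

(* Main.v *)
Require Import Defs.
From HB Require Import structures.
From mathcomp Require Import all_boot all_order all_algebra.
From mathcomp Require Import all_classical reals topology normedtype.
From mathcomp Require Import complex.

(** Why the theorem holds. If A is not essential, the span of the products
    misses a ball, so Hahn-Banach gives a bounded functional f on A that kills
    every product ab but is nonzero at some point x0. The evaluation F of
    bidual elements at f then kills every Arens product: f . a = 0 for all a,
    hence n . f = 0, hence <m [] n, f> = <m, n . f> = 0 ([canon_arens]).

    A functional F on a Banach algebra C that kills all products makes
    D a := F(a) F a derivation from C to its dual, since all three terms of the
    Leibniz rule vanish ([annihilator_derivation]). On the other hand every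
    approximately inner D satisfies D a a = 0, because
    <a . x - x . a, a> = <x, aa> - <x, aa> = 0 ([inner_diag0]). So when C is
    approximately weakly amenable, F(a)^2 = 0 for all a and F = 0
    ([awa_annihilator0]). For C the bidual of A this contradicts
    F(canon x0) = f x0 != 0.

    The Hahn-Banach theorem is obtained in its sublinear form. Among the
    sublinear functionals below a given p there is a minimal one, by Zorn's
    lemma, and a minimal sublinear functional is linear; working with total
    functions rather than partial linear maps replaces the one-dimensional
    extension step by an infimum along a ray ([sublinear_directional]). Applied
    to the distance to a subspace, it yields the separating functional over the
    reals ([sublinear_separation]); over the complex numbers
    x |-> g x - i g (i x) turns a real-linear g into a complex-linear one
    ([complex_separation]). *)

Set Implicit Arguments.
Unset Strict Implicit.
Unset Printing Implicit Defensive.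
Import Order.TTheory GRing.Theory Num.Theory.
Import numFieldNormedType.Exports.
Local Open Scope classical_set_scope.
Local Open Scope ring_scope.

(** * Sublinear functionals and the Hahn-Banach theorem *)

Section sublinear.
Variables (R : realType) (V : lmodType R).
Implicit Types (p q : V -> R) (x y : V).

(** The inequality for positive t already forces p 0 = 0 and equality in the
    second clause ([sublinear0], [sublinearZ]); asking for less shortens the
    verification for functionals defined as infima. *)
Definition sublinear p :=
  (forall x y, p (x + y) <= p x + p y) /\
  (forall (t : R) x, 0 < t -> p (t *: x) <= t * p x).

Lemma sublinear0 p : sublinear p -> p 0 = 0.
Proof.
move=> [pD pZ]; apply/eqP; rewrite eq_le; apply/andP; split.
  have := pZ 2^-1 0 ltac:(by rewrite invr_gt0 ltr0n).
  by rewrite scaler0 mulrC ler_pdivlMr ?ltr0n// mulr_natr mulr2n gerDl.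
by have := pD 0 0; rewrite addr0 lerDl.
Qed.

Lemma sublinear_opp_ge p x : sublinear p -> - p (- x) <= p x.
Proof.
move=> ps; have [pD _] := ps; rewrite lerNl -subr_ge0 opprK addrC.
by rewrite -(sublinear0 ps) -[X in p X](subrr x).
Qed.

Lemma sublinearZ p (t : R) x : sublinear p -> 0 < t -> p (t *: x) = t * p x.
Proof.
move=> [_ pZ] t0; apply/eqP; rewrite eq_le pZ//= -ler_pdivlMl//.
have := pZ t^-1 (t *: x); rewrite invr_gt0 => /(_ t0).
by rewrite scalerA mulVf ?gt_eqF// scale1r.
Qed.

(** The common source of the three sublinear functionals used below: the
    infimum of a chain, the infimum along a ray, and the distance to a
    subspace. No member of the family need be sublinear by itself; it is enough
    that the two inequalities hold up to a change of index. *)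
Lemma sublinear_inf (I : Type) (D : set I) (F : I -> V -> R) :
    D !=set0 -> (forall x, has_lbound [set F i x | i in D]) ->
    (forall i j x y, D i -> D j ->
      exists2 k, D k & F k (x + y) <= F i x + F j y) ->
    (forall i (t : R) x, D i -> 0 < t ->
      exists2 k, D k & F k (t *: x) <= t * F i x) ->
  sublinear (fun x => inf [set F i x | i in D]).
Proof.
move=> [i0 Di0] lb FD FZ.
have ne x : [set F i x | i in D] !=set0 by exists (F i0 x), i0.
split=> [x y|t x t0].
  rewrite -lerBlDr; apply: lb_le_inf => // _ [i Di <-].
  rewrite lerBlDr -lerBlDl; apply: lb_le_inf => // _ [j Dj <-].
  rewrite lerBlDl; have [k Dk] := FD i j x y Di Dj.
  by apply: le_trans; apply: ge_inf => //; exists k.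
rewrite -ler_pdivrMl//; apply: lb_le_inf => // _ [i Di <-].
rewrite ler_pdivrMl//; have [k Dk] := FZ i t x Di t0.
by apply: le_trans; apply: ge_inf => //; exists k.
Qed.

(** The infimum is finite because a sublinear q below p satisfies
    q x >= - q (- x) >= - p (- x). *)
Lemma sublinear_chain_inf p (C : set (V -> R)) : C !=set0 ->
    (forall q, C q -> sublinear q /\ forall x, q x <= p x) ->
    (forall q r, C q -> C r -> (forall x, q x <= r x) \/ (forall x, r x <= q x)) ->
  exists2 q, sublinear q & forall r, C r -> forall x, q x <= r x.
Proof.
move=> C0 Cp Ctot.
have lb x : has_lbound [set q x | q in C].
  exists (- p (- x)) => _ [q Cq <-]; have [qs qp] := Cp q Cq.
  by apply: le_trans (sublinear_opp_ge x qs); rewrite lerN2.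
exists (fun x => inf [set q x | q in C]); last first.
  by move=> r Cr x; apply: ge_inf => //; exists r.
apply: sublinear_inf => //.
  move=> q r x y Cq Cr; have [[qD _] _] := Cp q Cq; have [[rD _] _] := Cp r Cr.
  have [qr|rq] := Ctot q r Cq Cr.
    by exists q => //; apply: le_trans (qD _ _) _; rewrite lerD2l.
  by exists r => //; apply: le_trans (rD _ _) _; rewrite lerD2r.
by move=> q t x Cq t0; have [[_ qZ] _] := Cp q Cq; exists q => //; exact: qZ.
Qed.

Lemma sublinear_minimal p : sublinear p ->
  exists q, [/\ sublinear q, forall x, q x <= p x &
    forall r, sublinear r -> (forall x, r x <= q x) -> r = q].
Proof.
move=> ps.
pose T := {q : V -> R | sublinear q /\ forall x, q x <= p x}.
(* Zorn's lemma provides maximal elements, so the pointwise order is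
   reversed. *)
pose le (q r : T) := `[< forall x, sval r x <= sval q x >].
have [||||[q [qs qp]] qmin] := @Zorn T le.
- by move=> t; apply/asboolP.
- move=> r s t /asboolP rs /asboolP st; apply/asboolP => x.
  exact: le_trans (st x) (rs x).
- move=> [s sP] [t tP] /asboolP st /asboolP ts; apply: eq_exist => /=.
  by apply/funext => x; apply/eqP; rewrite eq_le; apply/andP; split; [exact: ts|exact: st].
- move=> A Atot; have [[s0 As0]|A0] := pselect (exists s, A s); last first.
    by exists (exist _ p (conj ps (fun x => lexx _))) => s As; case: A0; exists s.
  have [|||q qs qA] := @sublinear_chain_inf p [set sval s | s in A].
  + by exists (sval s0), s0.
  + by move=> _ [[s sP] _ <-].
  + move=> _ _ [s As <-] [t At <-].
    by have [/asboolP|/asboolP] := Atot s t As At; [right|left].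
  + have qp x : q x <= p x.
      by case: (svalP s0) => _ sp; apply: le_trans (sp x); apply: qA; exists s0.
    exists (exist _ q (conj qs qp)) => s As; apply/asboolP => x /=.
    by apply: qA; exists s.
exists q; split=> // r rs rq.
have rp x : r x <= p x := le_trans (rq x) (qp x).
by have /(congr1 sval) := qmin (exist _ r (conj rs rp)) ltac:(exact/asboolP).
Qed.

(** With t = 0 and t = 1, the infimum over t >= 0 of p (x + t x0) - t p x0 is
    seen to be below p x and below p (x + x0) - p x0. It serves twice: at a
    minimal p it yields additivity, and before minimization it forces the value
    p x0 at x0. *)
Lemma sublinear_directional p x0 : sublinear p ->
  exists q, [/\ sublinear q, forall x, q x <= p x &
    forall x, q x <= p (x + x0) - p x0].
Proof.
move=> ps; have [pD _] := ps.
pose F (t : R) x := p (x + t *: x0) - t * p x0.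
have lb x : has_lbound [set F t x | t in [set t | 0 <= t]].
  exists (- p (- x)) => _ [t /= t0 <-]; rewrite lerBrDr addrC lerBlDr.
  have -> : t * p x0 = p (t *: x0).
    move: t0; rewrite le_eqVlt => /predU1P[<-|t0].
      by rewrite mul0r scale0r (sublinear0 ps).
    by rewrite sublinearZ.
  by have := pD (x + t *: x0) (- x); rewrite addrAC subrr add0r.
exists (fun x => inf [set F t x | t in [set t | 0 <= t]]); split.
- apply: sublinear_inf => //; first by exists 0 => /=.
    move=> s t x y /= s0 t0; exists (s + t); first exact: addr_ge0.
    rewrite /F scalerDl mulrDl [leRHS]addrACA -opprD lerD2r.
    by rewrite addrACA; exact: pD.
  move=> s t x /= s0 t0; exists (t * s); first by rewrite mulr_ge0// ltW.
  by rewrite /F -scalerA -scalerDr mulrBr mulrA sublinearZ.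
- move=> x; apply: ge_inf => //; exists 0 => //=.
  by rewrite /F scale0r mul0r addr0 subr0.
- move=> x; apply: ge_inf => //; exists 1 => //=.
  by rewrite /F scale1r mul1r.
Qed.

(** By minimality the directional infimum of q at y is q itself, that is
    q x <= q (x + y) - q y. *)
Lemma minimal_sublinear_linear q : sublinear q ->
    (forall r, sublinear r -> (forall x, r x <= q x) -> r = q) ->
  linear (q : V -> R^o).
Proof.
move=> qs qmin; have [qD _] := qs.
have addq x y : q (x + y) = q x + q y.
  apply/eqP; rewrite eq_le qD /=.
  have [r [rs rq ry]] := sublinear_directional y qs.
  by rewrite -lerBrDr -{1}(qmin _ rs rq); exact: ry.
have q0 := sublinear0 qs.
have oppq x : q (- x) = - q x.
  by apply/eqP; rewrite -addr_eq0 -addq addNr q0.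
have scaleq (t : R) x : q (t *: x) = t * q x.
  have [t0|t0|->] := ltgtP t 0; last by rewrite scale0r mul0r.
    by rewrite -[t]opprK scaleNr oppq sublinearZ ?oppr_gt0// !mulNr.
  exact: sublinearZ.
by move=> t x y; rewrite addq scaleq.
Qed.

(** A linear f below the directional infimum at x0 satisfies
    f (- x0) <= p 0 - p x0, which is the bound missing from f x0 <= p x0. *)
Theorem hahn_banach_sublinear p x0 : sublinear p ->
  exists2 f : V -> R^o, linear f & (forall x, f x <= p x) /\ f x0 = p x0.
Proof.
move=> ps; have [r [rs rp rx0]] := sublinear_directional x0 ps.
have [f [fs fr fmin]] := sublinear_minimal rs.
have flin := minimal_sublinear_linear fs fmin.
exists f => //; split=> [x|]; first exact: le_trans (fr x) (rp x).
apply/eqP; rewrite eq_le (le_trans (fr _) (rp _))/=.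
have := le_trans (fr (- x0)) (rx0 (- x0)); rewrite addNr (sublinear0 ps) sub0r.
by have := sublinear_opp_ge x0 fs; rewrite lerNl; move=> a b; rewrite -lerN2 (le_trans a).
Qed.

(** The distance to W measured by N is a sublinear functional below N that
    vanishes on W and is at least e at x0. A linear functional below it is
    nonpositive on W, hence zero there since W is stable by opposite. *)
Lemma sublinear_separation (N : V -> R) (W : set V) x0 (e : R) :
    sublinear N -> (forall x, 0 <= N x) ->
    W 0 -> (forall (t : R) x y, W x -> W y -> W (t *: x + y)) ->
    0 < e -> (forall w, W w -> e <= N (x0 - w)) ->
  exists2 f : V -> R^o, linear f &
    [/\ forall x, f x <= N x, forall w, W w -> f w = 0 & 0 < f x0].
Proof.
move=> Ns N0 W0 WP e0 We; have [ND NZ] := Ns.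
have WZ (t : R) x : W x -> W (t *: x) by move=> Wx; rewrite -[_ *: _]addr0; exact: WP.
pose F w x := N (x - w).
pose p x := inf [set F w x | w in W].
have lb x : has_lbound [set F w x | w in W] by exists 0 => _ [w _ <-]; exact: N0.
have ps : sublinear p.
  apply: sublinear_inf => //; first by exists 0.
    move=> v w x y Wv Ww; exists (v + w); first by have := WP 1 _ _ Wv Ww; rewrite scale1r.
    by rewrite /F opprD addrACA.
  move=> w t x Ww t0; exists (t *: w); first exact: WZ.
  by rewrite /F -scalerBr; exact: NZ.
have [f flin [fp fx0]] := hahn_banach_sublinear x0 ps.
have fW w : W w -> f w <= 0.
  move=> Ww; apply: le_trans (fp w) _; apply: ge_inf => //; exists w => //.
  by rewrite /F subrr; exact: sublinear0.
have f0 : f 0 = 0 by have := flin (-1) 0 0; rewrite scaler0 addr0 scaleN1r addNr.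
exists f => //; split.
- move=> x; apply: le_trans (fp x) _; apply: ge_inf => //; exists 0 => //.
  by rewrite /F subr0.
- move=> w Ww; apply/eqP; rewrite eq_le fW//=.
  have := fW _ (WZ (-1) _ Ww); have := flin (-1) w 0.
  by rewrite !addr0 f0 addr0 => ->; rewrite scaleN1r oppr_le0.
- rewrite fx0; apply: lt_le_trans e0 _; apply: lb_le_inf; first by exists (F 0 x0), 0.
  by move=> _ [w Ww <-]; exact: We.
Qed.
End sublinear.

(** * Separation of points from subspaces by bounded functionals *)

(** A positive distance to W replaces the closedness of W. Stated as a property
    of a space over any scalar field, so that the real and the complex theorems
    below feed the same algebraic argument. *)
Definition functionals_separate_subspaces (K : scalarFieldType) (V : normedModType K) :=
  forall (W : set V) (x0 : V) (e : K),
    W 0 -> (forall (k : K) x y, W x -> W y -> W (k *: x + y)) ->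
    0 < e -> (forall w, W w -> e <= `|x0 - w|) ->
  exists f : dual V, (forall w, W w -> f w = 0) /\ f x0 != 0.

Lemma real_separation (R : realType) (V : normedModType R) :
  functionals_separate_subspaces V.
Proof.
move=> W x0 e W0 WP e0 We.
have Ns : sublinear (fun x : V => `|x|).
  split=> [x y|t x t0]; first exact: ler_normD.
  by rewrite normrZ gtr0_norm.
have [f flin [fN fW fx0]] :=
  sublinear_separation Ns (fun x => normr_ge0 x) W0 WP e0 We.
have fb : exists M : R, forall x, `|f x| <= M * `|x|.
  exists 1 => x; rewrite mul1r ler_norml fN andbT lerNl.
  have -> : - f x = f (- x).
    by have := flin (-1) x 0; rewrite !scaleN1r (fW _ W0) !addr0.
  by rewrite -[leRHS]normrN.
by exists (Dual flin fb); split => //=; rewrite gt_eqF.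
Qed.

(** A separate name for V, so that it can carry a real module structure next to
    its complex one. *)
Definition realification (R : realType) (V : lmodType R[i]%C) : Type := V.

Section realification.
Variables (R : realType) (V : lmodType R[i]%C).
HB.instance Definition _ := GRing.Zmodule.on (realification V).
Local Notation rscale := (fun (t : R) (x : realification V) =>
  (t%:C%C *: (x : V)) : realification V).
Lemma rscaleA (s t : R) x : rscale s (rscale t x) = rscale (s * t) x.
Proof. by rewrite /= scalerA rmorphM. Qed.
Lemma rscale1 : left_id 1 rscale.
Proof. by move=> x; rewrite /= rmorph1 scale1r. Qed.
Lemma rscaleDr : right_distributive rscale +%R.
Proof. by move=> t x y; rewrite /= scalerDr. Qed.
Lemma rscaleDl x : {morph rscale^~ x : s t / s + t}.
Proof. by move=> s t; rewrite /= rmorphD scalerDl. Qed.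
HB.instance Definition _ := GRing.Zmodule_isLmodule.Build R (realification V)
  rscaleA rscale1 rscaleDr rscaleDl.
Lemma realification_scaleE (t : R) (x : realification V) :
  t *: x = (t%:C%C *: (x : V)).
Proof. by []. Qed.
End realification.

(** The real part g of the functional comes from real separation in the
    realification, and the functional is recovered from its real part as
    g x - i g (i x). It vanishes on W because W is stable by i. *)
Lemma complex_separation (R : realType) (V : normedModType R[i]%C) :
  functionals_separate_subspaces V.
Proof.
move=> W x0 e W0 WP e0 We.
have rE (x : R[i]%C) : 0 <= x -> x = (complex.Re x)%:C%C.
  by move=> x_ge0; rewrite RRe_real// ger0_real.
pose N (x : realification V) : R := complex.Re `|x : V|.
have NE (x : V) : (N x)%:C%C = `|x| by rewrite /N -rE.
have Ns : sublinear N.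
  split=> [x y|t x t0]; rewrite -lecR.
    by rewrite rmorphD/= !NE; exact: ler_normD.
  by rewrite rmorphM/= !NE realification_scaleE normrZ ger0_norm// lecR ltW.
have N0 x : 0 <= N x by rewrite -lecR NE normr_ge0.
have Re0 : 0 < complex.Re e by rewrite -ltcR -(rE _ (ltW e0)).
have ReW w : W w -> complex.Re e <= N (x0 - w).
  by move=> Ww; rewrite -lecR -(rE _ (ltW e0)) NE We.
have WPr (t : R) (x y : realification V) : W x -> W y -> W (t *: x + y).
  exact: WP.
have [g glin [gN gW gx0]] := sublinear_separation Ns N0 W0 WPr Re0 ReW.
have gD (x y : V) : g (x + y) = g x + g y.
  by have := glin 1 x y; rewrite !scale1r.
have gZ (t : R) (x : V) : g (t%:C%C *: x) = t * g x.
  by have := glin t x 0; rewrite (gW _ W0) !addr0.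
have gopp (x : V) : g (- x) = - g x.
  by have := gZ (-1) x; rewrite rmorphN1 scaleN1r mulN1r.
have gle (x : V) : `|g x| <= N x.
  rewrite ler_norml gN andbT lerNl.
  by rewrite -gopp; apply: le_trans (gN _) _; rewrite -lecR !NE normrN.
pose f (x : V) : R[i]%C^o := (g x)%:C%C - 'i%C * (g ('i%C *: x))%:C%C.
have flin : linear f.
  move=> k x y; rewrite /f.
  (* It suffices to know g on real multiples of z and of i z. *)
  have gk z : g (k *: z) = complex.Re k * g z + complex.Im k * g ('i%C *: z).
    by rewrite {1}(complexE k) (mulrC 'i%C) scalerDl gD -scalerA !gZ.
  have -> : 'i%C *: (k *: x + y) = k *: ('i%C *: x) + 'i%C *: y.
    by rewrite scalerDr !scalerA mulrC.
  have ii : 'i%C *: ('i%C *: x) = - x by rewrite scalerA -expr2 sqr_i scaleN1r.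
  rewrite !gD !gk ii gopp -[k *: _]/(k * _).
  by case: k {gk} => a b; simpc.
have fb : exists M : R[i]%C, forall x, `|f x| <= M * `|x|.
  exists 2%:R => x; rewrite mulr_natl mulr2n.
  have gC (z : V) : `|(g z)%:C%C : R[i]%C| <= `|z|.
    by rewrite normc_def/= expr0n addr0 sqrtr_sqr -NE lecR.
  apply: le_trans (ler_normB _ _) _; apply: lerD; first exact: gC.
  have ni : `|'i%C : R[i]%C| = 1.
    by rewrite normc_def/= expr0n expr1n add0r sqrtr1.
  by rewrite normrM ni mul1r; apply: le_trans (gC _) _; rewrite normrZ ni mul1r.
exists (Dual flin fb); split => /= [w Ww|].
  have Wiw : W ('i%C *: w) by rewrite -[_ *: _]addr0; exact: WP.
  by rewrite /f (gW _ Ww) (gW _ Wiw) rmorph0 mulr0 subr0.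
by rewrite /f eq_complex /= negb_and; simpc; rewrite gt_eqF.
Qed.

(** * The span of a set *)
Lemma linear_span_submod (K : numFieldType) (V : lmodType K) (S : set V) k x y :
  linear_span S x -> linear_span S y -> linear_span S (k *: x + y).
Proof.
move=> [n [c [v [vS ->]]]] [m [d [w [wS ->]]]].
exists (n + m)%N.
exists (fun i : 'I_(n + m) => match fintype.split i with inl j => k * c j | inr j => d j end).
exists (fun i : 'I_(n + m) => match fintype.split i with inl j => v j | inr j => w j end).
split; first by move=> i; case: (fintype.split i).
rewrite big_split_ord scaler_sumr; congr (_ + _); apply: eq_bigr => i _.
  by rewrite (unsplitK (inl i)) scalerA.
by rewrite (unsplitK (inr i)).
Qed.

Lemma linear_span0 (K : numFieldType) (V : lmodType K) (S : set V) :
  linear_span S 0.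
Proof.
exists 0%N, (fun=> 0), (fun=> 0); split; first by case.
by rewrite big_ord0.
Qed.

Lemma subset_linear_span (K : numFieldType) (V : lmodType K) (S : set V) :
  S `<=` linear_span S.
Proof.
by move=> x Sx; exists 1%N, (fun=> 1), (fun=> x); rewrite big_ord1 scale1r.
Qed.

Lemma not_dense_dist (K : numFieldType) (V : normedModType K) (W : set V) :
  ~ dense W -> exists x0 (e : K), 0 < e /\ forall w, W w -> e <= `|x0 - w|.
Proof.
move=> /denseNE[O [[x0 [Oo Ox0]] OW]].
have /nbhs_ballP[e /= e0 eO] : nbhs x0 O by exact: open_nbhs_nbhs.
exists x0, e; split => // w Ww; rewrite real_leNgt ?normr_real ?gtr0_real//.
apply/negP => xw; suff : (O `&` W) w by rewrite OW.
by split => //; apply: eO; rewrite -ball_normE.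
Qed.

(** * Functionals that vanish on products *)

(** Inner derivations a |-> a . x - x . a vanish on the diagonal, and evaluation
    at a is norm continuous. *)
Lemma inner_diag0 (K : scalarFieldType) (C : banachAlgType K) (D : C -> dual C) :
  approximately_inner D -> forall a, D a a = 0.
Proof.
move=> [I [le [x [dle xD]]]] a.
have FF := tails_proper dle.
apply/eqP; rewrite -normr_le0; apply/ler_addgt0Pr => e e0; rewrite add0r.
have a1 : 0 < `|a| + 1 by rewrite ltr_wpDl.
have /cvgrPdist_lt/(_ _ (divr_gt0 e0 a1)) near_D := xD a.
have [i Di] := filter_ex near_D.
have -> : D a a = (D a - (lact a (x i) - ract (x i) a)) a.
  by rewrite !dualB dual_lactE dual_ractE subrr subr0.
apply: le_trans (ler_dual _ _) _.
(* Dividing by |a| + 1 rather than |a| also covers a = 0. *)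
apply: (@le_trans _ _ (e / (`|a| + 1) * (`|a| + 1))); last by rewrite divfK// gt_eqF.
by apply: ler_pM => //; [exact: ltW|rewrite lerDl].
Qed.

(** All three terms of the Leibniz rule vanish: F (ab) = 0 on one side, and on
    the other both actions of C on F produce values of F at products. *)
Lemma annihilator_derivation (K : scalarFieldType) (C : banachAlgType K)
    (F : dual C) :
  (forall a b, F (bmul a b) = 0) -> derivation (fun a => F a *: F).
Proof.
move=> F0; split.
- by move=> k a b; rewrite linearP scalerDl scalerA.
- by exists (`|F| * `|F|) => a; rewrite normrZ mulrAC ler_wpM2r// ler_dual.
- move=> a b; rewrite F0 scale0r; apply: dualP => c.
  by rewrite dualD dual_ractE dual_lactE !dualZ !F0 !scaler0 addr0.
Qed.

Lemma awa_annihilator0 (K : scalarFieldType) (C : banachAlgType K) (F : dual C) :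
  approximately_weakly_amenable C ->
  (forall a b, F (bmul a b) = 0) -> forall a, F a = 0.
Proof.
move=> awa F0 a; have := inner_diag0 (awa _ (annihilator_derivation F0)) a.
by rewrite dualZ => /eqP; rewrite mulf_eq0 orbb => /eqP.
Qed.

(** Vanishing on products passes to the bidual: the functional n . f is already
    zero. *)
Lemma canon_arens (K : scalarFieldType) (A : banachAlgType K) (f : dual A) :
  (forall a b, f (bmul a b) = 0) ->
  forall m n : bidual A, Defs.canon f (bmul m n) = 0.
Proof.
move=> f0 m n; rewrite /= (_ : arens_lact n f = 0) ?linear0//.
apply: dualP => a /=; rewrite (_ : ract f a = 0) ?linear0//.
by apply: dualP => b /=; exact: f0.
Qed.

Theorem awa_bidual_essential (K : scalarFieldType) (A : banachAlgType K) :
  functionals_separate_subspaces A ->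
  approximately_weakly_amenable (bidual A) -> essential A.
Proof.
move=> sep awa; apply: contrapT => /not_dense_dist[x0 [e [e0 x0e]]].
have [f [fS]] := sep _ _ _ (linear_span0 _) (@linear_span_submod _ _ _) e0 x0e.
have f0 a b : f (bmul a b) = 0.
  by apply: fS; apply: subset_linear_span; exists a => //; exists b.
have /(_ (Defs.canon x0)) := awa_annihilator0 awa (canon_arens f0).
by rewrite /= => ->; rewrite eqxx.
Qed.

Theorem theorem2p2 (R : realType) :
  (forall A : banachAlgType R[i]%C,
     approximately_weakly_amenable (bidual A) -> essential A) /\
  (forall A : banachAlgType R,
     approximately_weakly_amenable (bidual A) -> essential A).
Proof.
split=> A; apply: awa_bidual_essential.
- exact: complex_separation.
- exact: real_separation.
Qed.
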